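(* Let $\alpha,\beta\in\mathbb{C}$ with $\alpha\beta\neq 0$, let $\delta=-\beta^2/2$, and let $a_0$ be any cube root of $-\delta/\alpha$. Let $(a_n)_{n\ge 0}$ be the sequence of complex numbers determined by $$a_1=-\frac{\beta}{2\alpha a_0},\qquad a_2=0,\qquad a_3=-\frac{\beta}{6\alpha^2a_0^2}\left(\frac{\beta^2}{4\delta}+1\right),$$ and, for $n\ge 4$, $$a_n=\frac{1}{3\alpha a_0^2}\left(-\alpha\sum_{k=1}^{n-1}a_k\sum_{j=0}^{n-k}a_ja_{n-k-j}-\alpha a_0\sum_{k=1}^{n-1}a_ka_{n-k}-\frac32\beta a_{n-1}+\sum_{k=1}^{n-2}\bigl(2k^2+k(2-n)\bigr)a_ka_{n-2-k}\right).$$ Then the formal series $\sum_{n=0}^\infty a_nx^{-n}$ is of exact Gevrey order one.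
   Context: For $k>0$, a formal series $\sum_{n=0}^\infty a_n x^{-n}$ with complex coefficients is called a series of Gevrey order $k$ if there exist constants $M,C>0$ such that $|a_n|\le C\,(n!)^{1/k}M^n$ for all $n\in\mathbb{N}$. It is called a series of exact Gevrey order $k$ if it is of Gevrey order $k$ and there is no $k'>k$ such that it is of Gevrey order $k'$. Background (not needed to understand the claim): the series $\sum a_n x^{-n}$ are exactly the formal power series in $x^{-1}$ satisfying $u''=\frac{(u')^2}{u}-\frac{u'}{x}+\alpha u^2+\frac{3}{2}\frac{\beta}{x}+\frac{\delta}{u}$, which is obtained from the third Painlevé equation with $\gamma=0$ by the substitution $w(z)=z^{1/3}u(x)$, $x=\frac32 z^{2/3}$. *)

(* Defs.v *)
From HB Require Import structures.
From mathcomp Require Export all_boot all_order all_algebra.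
From mathcomp Require Export reals exp complex.

Set Implicit Arguments.
Unset Strict Implicit.
Unset Printing Implicit Defensive.

Import Order.TTheory GRing.Theory Num.Theory.

Local Open Scope ring_scope.
Local Open Scope complex_scope.

(* The formal series \sum_n a_n x^(-n) is represented by its coefficient
   sequence a. The norm of R[i] takes its values in R[i], hence the cast %:C
   of the real bound; [<=] on R[i] restricts to the order of R on reals. *)
Definition gevrey (R : realType) (k : R) (a : nat -> R[i]) : Prop :=
  0 < k /\
  exists M C : R, [/\ 0 < M, 0 < C &
    forall n : nat, `|a n| <= (C * (n`!%:R `^ k^-1) * M ^+ n)%:C].

Definition exact_gevrey (R : realType) (k : R) (a : nat -> R[i]) : Prop :=
  gevrey k a /\ ~ exists k' : R, k < k' /\ gevrey k' a.

(* Main.v *)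
Require Import Defs.
From mathcomp Require Import ring lra zify.

Set Implicit Arguments.
Unset Strict Implicit.
Unset Printing Implicit Defensive.

Import Order.TTheory GRing.Theory Num.Theory.

(** Why the series has exact Gevrey order one.

    Put t = beta / (2 alpha a_0^2) and a_n = a_0 t^n b_n.  Since
    delta = - beta^2 / 2, one has 2 alpha a_0 t^2 = 1, and all parameters
    scale out: with y = t / x and theta = y d/dy, the series
    B = sum b_n y^n satisfies

      B^3 + 3 y B - 1 = 2 y^2 (B theta^2 B - (theta B)^2),   B = 1 - y - ...,

    so the b_n are universal real numbers (rescale_rec, normalized_real), and
    it is enough to show that b_n grows like n! up to geometric factors.

    Write B = 1 - g.  The equation takes the form

      (1 - g) (3 g - 3 y - 2 y^2 theta^2 g) = 2 (y theta g)^2 - g^3,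

    in which the linear part of the second factor compares 3 g_n with
    2 (n-2)^2 g_(n-2), while every other term is quadratic or cubic in g.  Let
    g = y + r.  The heart of the proof is that r_n >= 0 and, for n >= 5,

      2 ((n-2)^2 - 2) r_(n-2) <= 3 r_n <= 2 ((n-1)^2 - 2) r_(n-2),

    by strong induction (pinched_next, neg_tail_pinched).  The induction closes
    because this two-step bound controls the nonlinear terms by itself: since
    the upper factor at a small index does not exceed the lower factor at a
    large index, an index can be lowered by two in one factor of a product
    and raised by two in the result, which gives 3 r_i r_j <= r_(i+j-3)
    (pinched_supermul).  Hence the coefficient of index n in r^2 is at most
    about n r_(n-3) / 3, and at index n all the remaining terms fit into the
    margins - 4 r_(n-2) and (4n - 10) r_(n-2) that the bounds leave around
    2 (n-2)^2 r_(n-2).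

    The lower factor and the upper factor are at least n (n-1) / 3 and at most
    3 n (n-1) respectively, so that n! / 3^n <= r_n <= n!
    (pinched_fact_bounds).  The right inequality is Gevrey order one, and the
    left one excludes every order k' > 1, because (n!)^(1 - 1/k') outgrows all
    geometric sequences (fact_powR_outgrows). *)

Local Open Scope ring_scope.
Local Open Scope complex_scope.

(** * Coefficient sequences and their convolutions *)

Definition conv (R : pzRingType) (f g : nat -> R) (n : nat) : R :=
  \sum_(i < n.+1) f i * g (n - i)%N.

(** The coefficients of the image under y d/dy. *)
Definition euler (R : pzRingType) (f : nat -> R) (n : nat) : R := n%:R * f n.

Definition shift (R : pzRingType) (d : nat) (f : nat -> R) (n : nat) : R :=
  if (n < d)%N then 0 else f (n - d)%N.

Lemma sum_nat_eq0 (V : nmodType) (F : nat -> V) a b :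
  (forall i, (a <= i < b)%N -> F i = 0) -> \sum_(a <= i < b) F i = 0.
Proof. by move=> h; rewrite big_nat_cond big1 // => i /andP[/h]. Qed.

Lemma conv_shift (R : comPzRingType) (f g : nat -> R) (d n : nat) :
  conv f (shift d g) (n + d) = conv f g n.
Proof.
rewrite /conv -addSn -!(big_mkord xpredT (fun i => f i * _ (_ - i)%N)).
rewrite (big_cat_nat (n := n.+1)) //=; last by rewrite leq_addr.
rewrite [X in _ + X]sum_nat_eq0 ?addr0 => [|i /andP[h1 h2]]; last first.
  by rewrite /shift ifT ?mulr0//; lia.
apply: eq_big_nat => i /andP[_ hi]; rewrite /shift ifF; last by lia.
by congr (_ * g _); lia.
Qed.

Lemma conv_le (R : numDomainType) (f g f' g' : nat -> R) (n : nat) (c d : R) :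
  (forall i, (i <= n)%N ->
    c * (f i * g (n - i)%N) <= d * (f' i * g' (n - i)%N)) ->
  c * conv f g n <= d * conv f' g' n.
Proof.
move=> h; rewrite /conv !mulr_sumr; apply: ler_sum => i _.
by apply: h; rewrite -ltnS.
Qed.

(** * Two-step ratio bounds and their consequences *)

(** Coefficients of E = 3 r - y^3 - y^4 - 2 y^2 theta^2 r, whose linear part is
    the one of the differential equation.  The two monomials are there to make
    E vanish below index 5, where the general formula would pick up the initial
    values; see [balance_excess_rec]. *)
Definition excess (R : pzRingType) (r : nat -> R) (n : nat) : R :=
  if (n < 5)%N then 0 else 3 * r n - 2 * (n - 2)%:R ^+ 2 * r (n - 2)%N.

(** The values at 5 and 6 follow from the recurrence; they start the induction
    on the parities in [pinched_step]. *)
Definition seeded (R : fieldType) (r : nat -> R) : Prop :=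
  [/\ forall i, (i < 3)%N -> r i = 0, r 3 = 1 / 3, r 4 = 1 / 3, r 5 = 2
    & r 6 = 40 / 9].

(** The exact recurrence is 3 r_(m+2) = 2 m^2 r_m + E_(m+2).  The lower factor
    allows E to be as small as - 4 r_m, which absorbs the term - 3 r_m coming
    from the cube of g.  The upper factor is the lower one at the next index,
    so that the ratio r_(m+2) / r_m never decreases when m grows. *)
Definition pinched (R : numFieldType) (r : nat -> R) (m : nat) : Prop :=
  2 * (m%:R ^+ 2 - 2) * r m <= 3 * r m.+2 <= 2 * (m.+1%:R ^+ 2 - 2) * r m.

(** The bounds up to an index N, as the strong induction provides them. *)
Definition pinched_below (R : numFieldType) (r : nat -> R) (N : nat) : Prop :=
  forall m, (3 <= m)%N -> (m.+2 < N)%N -> pinched r m.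

Lemma excess_pinched (R : realFieldType) (r : nat -> R) (m : nat) : (3 <= m)%N ->
  pinched r m <->
  - 4 * r m <= excess r m.+2 <= (4 * m%:R - 2) * r m.
Proof.
move=> m3; rewrite /pinched /excess ifF; last by lia.
rewrite (_ : (m.+2 - 2 = m)%N); last by lia.
rewrite -[m.+1]addn1 natrD.
by split=> /andP[h1 h2]; apply/andP; split; lra.
Qed.

Section Estimates.
Context (R : realFieldType) (r : nat -> R) (N : nat).
Hypotheses (rS : seeded r) (hN : (7 <= N)%N) (rP : pinched_below r N).

Lemma pinched_ge0 i : (i < N)%N -> 0 <= r i.
Proof.
have [r0 r3 r4 r5 r6] := rS.
elim/ltn_ind: i => i IH iN.
have [i3|i3] := ltnP i 3; first by rewrite r0.
have [->|i3'] := eqVneq i 3%N; first by rewrite r3; lra.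
have [->|i4] := eqVneq i 4%N; first by rewrite r4; lra.
have [j jE] : exists j, i = j.+2 by exists (i - 2)%N; lia.
have j3 : (3 <= j)%N by lia.
have rj : 0 <= r j by apply: IH; lia.
rewrite jE in iN *; have /andP[h _] := rP j3 iN.
have hj : (3 : R) <= j%:R by rewrite ler_nat.
suff : 0 <= 3 * r j.+2 by lra.
apply: le_trans h; apply: mulr_ge0 => //; nra.
Qed.

(** The ratio r_(m+1) / r_m does not decrease when m grows by two, because the
    upper factor at m is the lower factor at m + 1.  So its values at 4 and 5,
    which are 6 and 20/9, bound it from below forever. *)
Lemma pinched_step m : (4 <= m)%N -> (m.+1 < N)%N -> 20 * r m <= 9 * r m.+1.
Proof.
have [r0 r3 r4 r5 r6] := rS.
elim/ltn_ind: m => m IH m4 mN.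
have [->|m4'] := eqVneq m 4%N; first by rewrite r4 r5; lra.
have [->|m5] := eqVneq m 5%N; first by rewrite r5 r6; lra.
have [j jE] : exists j, m = j.+2 by exists (m - 2)%N; lia.
rewrite jE in m4 m4' m5 mN *.
have /andP[_ h1] : pinched r j by apply: rP; lia.
have /andP[h2 _] : pinched r j.+1 by apply: rP; lia.
have h3 : 20 * r j <= 9 * r j.+1 by apply: IH; lia.
have hj : (4 : R) <= j.+1%:R by rewrite ler_nat; lia.
have : (2 * (j.+1%:R ^+ 2 - 2)) * (20 * r j) <= (2 * (j.+1%:R ^+ 2 - 2)) * (9 * r j.+1).
  by apply: ler_wpM2l => //; nra.
lra.
Qed.

Lemma pinched_mono m : (m.+1 < N)%N -> r m <= r m.+1.
Proof.
have [r0 r3 r4 r5 r6] := rS.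
move=> mN; have [m3|m3] := ltnP m 3; first by rewrite r0 //; apply: pinched_ge0.
have [->|m3'] := eqVneq m 3%N; first by rewrite r3 r4.
have := @pinched_step m; rewrite mN => /(_ _ isT).
have := @pinched_ge0 m; have := @pinched_ge0 m.+1.
move=> /(_ mN) h1 /(_ (ltnW mN)) h2 h3; have := h3 ltac:(lia); lra.
Qed.

(** Lowering i by two divides r_i by at most 2 ((i-1)^2 - 2) / 3, and raising
    i + j - 5 by two multiplies r by at least 2 ((i+j-5)^2 - 2) / 3, which is
    no smaller as soon as j >= 4.  The descent ends at i = 3, where the
    inequality is an equality, or at i = 4, where it is monotonicity. *)
Lemma pinched_supermul i j :
  (3 <= i)%N -> (3 <= j)%N -> (i + j - 3 < N)%N -> 3 * (r i * r j) <= r (i + j - 3)%N.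
Proof.
have [r0 r3 r4 r5 r6] := rS.
elim/ltn_ind: i j => i IH j i3 j3 ijN.
have [->|i3'] := eqVneq i 3%N.
  by rewrite r3 (_ : (3 + j - 3 = j)%N); [lra|lia].
have [->|j3'] := eqVneq j 3%N.
  by rewrite r3 (_ : (i + 3 - 3 = i)%N); [lra|lia].
have [iE|i4] := eqVneq i 4%N.
  rewrite iE r4 (_ : (4 + j - 3 = j.+1)%N); last lia.
  have := @pinched_mono j; move=> /(_ ltac:(lia)); lra.
have [k kE] : exists k, i = k.+2 by exists (i - 2)%N; lia.
rewrite kE in i3 i3' i4 ijN *.
have h0 : 3 * (r k * r j) <= r (k + j - 3)%N by apply: IH; lia.
have [l lE] : exists l, (k + j - 3 = l)%N by exists (k + j - 3)%N.
have -> : (k.+2 + j - 3 = l.+2)%N by lia.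
rewrite lE in h0.
have /andP[_ h1] : pinched r k by apply: rP; lia.
have /andP[h2 _] : pinched r l by apply: rP; lia.
have kl : (k.+1%:R : R) <= l%:R by rewrite ler_nat; lia.
have k3 : (4 : R) <= k.+1%:R by rewrite ler_nat; lia.
have rl : 0 <= r l by apply: pinched_ge0; lia.
have rj : 0 <= r j by apply: pinched_ge0; lia.
set a : R := k.+1%:R in h1 kl k3; set b : R := l%:R in h2 kl.
have e1 : 3 * r k.+2 * r j <= 2 * (a ^+ 2 - 2) * r k * r j by apply: ler_wpM2r.
have e2 : 2 * (a ^+ 2 - 2) * (3 * (r k * r j)) <= 2 * (a ^+ 2 - 2) * r l.
  by apply: ler_wpM2l => //; nra.
have e3 : 2 * (a ^+ 2 - 2) * r l <= 2 * (b ^+ 2 - 2) * r l.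
  by apply: ler_wpM2r => //; nra.
lra.
Qed.

Lemma conv_sqr_ge0 m : (m <= N)%N -> 0 <= conv r r m.
Proof.
have [r0 _ _ _ _] := rS.
move=> mN; apply: sumr_ge0 => i _.
have [i0|i0] := posnP i; first by rewrite i0 r0 // mul0r.
have [->|im] := eqVneq (i : nat) m; first by rewrite subnn (r0 0) // mulr0.
by apply: mulr_ge0; apply: pinched_ge0; have := ltn_ord i; lia.
Qed.

Lemma excess_bounds i : (i < N)%N ->
  - 4 * shift 2 r i <= excess r i <= (4 * i%:R - 10) * shift 2 r i.
Proof.
have [r0 _ _ _ _] := rS; move=> iN.
have [i5|i5] := ltnP i 5.
  rewrite /excess i5 /shift; case: ifP => hi; rewrite ?r0 ?mulr0 ?lexx //; lia.
have [j jE] : exists j, i = j.+2 by exists (i - 2)%N; lia.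
have : pinched r j by apply: rP; lia.
rewrite excess_pinched; last lia.
rewrite /shift ifF jE; last lia.
rewrite (_ : (j.+2 - 2 = j)%N); last by lia.
move=> /andP[-> h] /=; apply: le_trans h _.
by rewrite -[j.+2]addn2 natrD; lra.
Qed.

(** Only the m indices from 3 to m + 2 contribute, and each contributes at most
    a third of r_(m+2) by supermultiplicativity. *)
Lemma conv_sqr_le m : (m.+2 < N)%N -> 3 * conv r r (m + 5) <= m%:R * r m.+2.
Proof.
have [r0 _ _ _ _] := rS.
move=> mN; rewrite /conv -(big_mkord xpredT (fun i => r i * r (m + 5 - i)%N)).
rewrite (big_cat_nat (n := 3)) //=; last by lia.
rewrite [X in X + _]sum_nat_eq0 ?add0r => [|i /andP[h1 h2]]; last first.
  by rewrite r0 ?mul0r.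
rewrite (big_cat_nat (n := m + 3)) /=; [|lia|lia].
rewrite [X in _ + X]sum_nat_eq0 ?addr0 => [|i /andP[h1 h2]]; last first.
  by rewrite (r0 (m + 5 - i)%N) ?mulr0 //; lia.
rewrite mulr_sumr (@le_trans _ _ (\sum_(3 <= i < m + 3) r m.+2)) //.
  apply: ler_sum_nat => i /andP[h1 h2].
  have := @pinched_supermul i (m + 5 - i).
  by rewrite (_ : (i + (m + 5 - i) - 3 = m.+2)%N); [apply|]; lia.
by rewrite sumr_const_nat addnK mulr_natl.
Qed.

Lemma shift_ge0 d k : (k < N)%N -> 0 <= shift d r k.
Proof.
by move=> kN; rewrite /shift; case: ifP => // _; apply: pinched_ge0; lia.
Qed.

(** A rougher form of the previous bound, valid at every index, so that it can
    be summed against r once more in [conv_cube_le]. *)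
Lemma conv_sqr_le_shift k : (k < N)%N -> 3 * conv r r k <= k%:R * shift 3 r k.
Proof.
have [r0 _ _ _ _] := rS.
move=> kN; have [k5|k5] := ltnP k 5.
  rewrite /conv big1 ?mulr0 => [|i _]; first by rewrite mulr_ge0 // shift_ge0.
  have [i3|i3] := ltnP i 3; first by rewrite r0 ?mul0r.
  by rewrite (r0 (k - i)%N) ?mulr0 //; lia.
have [m mE] : exists m, (k = m + 5)%N by exists (k - 5)%N; lia.
rewrite mE in kN *; rewrite (le_trans (@conv_sqr_le m _)) //; first by lia.
rewrite /shift ifF; last by lia.
rewrite (_ : (m + 5 - 3 = m.+2)%N); last by lia.
by rewrite ler_wpM2r ?ler_nat ?leq_addr // pinched_ge0 //; lia.
Qed.

Lemma conv_excess_bounds m : (m + 7 <= N)%N ->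
  - 4 * conv r r (m + 5) <= conv r (excess r) (m + 7)
    <= (4 * m%:R + 6) * conv r r (m + 5).
Proof.
have [r0 _ _ _ _] := rS.
move=> mN; rewrite -(conv_shift r r 2) -[X in _ <= X <= _]mul1r.
rewrite (_ : (m + 5 + 2 = m + 7)%N); last by lia.
have bnd i : (3 <= i <= m + 7)%N ->
    - 4 * (r i * shift 2 r (m + 7 - i)) <= r i * excess r (m + 7 - i)
      <= (4 * m%:R + 6) * (r i * shift 2 r (m + 7 - i)).
  move=> /andP[i3 im]; have [i5|i5] := ltnP (m + 5) i.
    by rewrite /excess /shift !ifT ?mulr0 ?lexx //; lia.
  rewrite ![_ * (r i * _)]mulrCA !ler_wpM2l //; try (by apply: pinched_ge0; lia).
    have /andP[_ h] := @excess_bounds (m + 7 - i) ltac:(lia).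
    rewrite (le_trans h) // ler_wpM2r ?shift_ge0 //; first lia.
    have : (3 : R) <= i%:R by rewrite ler_nat.
    by rewrite natrB // natrD; lra.
  by have /andP[] := @excess_bounds (m + 7 - i) ltac:(lia).
by apply/andP; split; apply: conv_le => i im; rewrite mul1r;
  (have [i3|i3] := ltnP i 3; [rewrite r0 // !(mul0r, mulr0)
                             |have /andP[] := bnd i ltac:(lia)]).
Qed.

(** Convolving (i r_i) with itself puts the weight i j on r_i r_j; i + j = m + 5
    bounds this weight by (m+5)^2 / 4, and i, j >= 3 makes it at least 2, which
    is what offsets the lower bound of [conv_excess_bounds]. *)
Lemma conv_euler_bounds m : (m + 5 < N)%N ->
  8 * conv r r (m + 5) <= 4 * conv (euler r) (euler r) (m + 5)
    <= (m + 5)%:R ^+ 2 * conv r r (m + 5).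
Proof.
have [r0 _ _ _ _] := rS.
move=> mN; have rr0 i : (i <= m + 5)%N -> 0 <= r i * r (m + 5 - i)%N.
  by move=> im; rewrite mulr_ge0 ?pinched_ge0 //; lia.
apply/andP; split; apply: conv_le => i im; have := rr0 i im; rewrite /euler.
  have [i3|i3] := ltnP i 3; first by rewrite r0 // !(mul0r, mulr0).
  have [j3|j3] := ltnP (m + 5 - i) 3.
    by rewrite (r0 (m + 5 - i)%N) // !(mul0r, mulr0).
  have : (3 : R) <= i%:R by rewrite ler_nat.
  have : (3 : R) <= (m + 5 - i)%:R by rewrite ler_nat.
  move: (r i) (r _) i%:R (_ - _)%:R => p q x y y3 x3 pq.
  have xy : 0 <= x * y - 2 by nra.
  have := mulr_ge0 xy pq; lra.
rewrite natrB //; move: (r i) (r _) i%:R (m + 5)%:R => p q x y pq.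
have := mulr_ge0 (sqr_ge0 (y - 2 * x)) pq; lra.
Qed.

Lemma conv_cube_ge0 m : (m <= N)%N -> 0 <= conv r (conv r r) m.
Proof.
have [r0 _ _ _ _] := rS.
move=> mN; apply: sumr_ge0 => i _.
have [i3|i3] := ltnP i 3; first by rewrite r0 ?mul0r.
have [->|im] := eqVneq (i : nat) m.
  by rewrite subnn /conv big_ord1 (r0 0) // mul0r mulr0.
by rewrite mulr_ge0 ?pinched_ge0 ?conv_sqr_ge0 //; have := ltn_ord i; lia.
Qed.

Lemma conv_cube_le m : (m + 7 <= N)%N ->
  9 * conv r (conv r r) (m + 7) <= (m + 4)%:R ^+ 2 * r (m + 3)%N.
Proof.
have [r0 _ _ _ _] := rS.
move=> mN.
have h1 : 3 * conv r (conv r r) (m + 7) <= (m + 4)%:R * conv r r (m + 4).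
  rewrite -(conv_shift r r 3) (_ : (m + 4 + 3 = m + 7)%N); last lia.
  apply: conv_le => i im.
  have [i3|i3] := ltnP i 3; first by rewrite r0 // !mul0r !mulr0.
  have [->|i7] := eqVneq i (m + 7)%N.
    by rewrite subnn /shift /conv big_ord1 (r0 0) // !(mul0r, mulr0).
  rewrite ![_ * (r i * _)]mulrCA ler_wpM2l ?pinched_ge0 //; first lia.
  rewrite (le_trans (@conv_sqr_le_shift _ _)) ?ler_wpM2r ?shift_ge0 ?ler_nat //; lia.
have h2 : 3 * conv r r (m + 4) <= (m + 4)%:R * r (m + 3)%N.
  rewrite (le_trans (@conv_sqr_le_shift _ _)) ?ler_wpM2l //; first by lia.
  rewrite /shift ifF; last by lia.
  rewrite (_ : (m + 4 - 3 = m.+1)%N); last by lia.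
  by rewrite addn3 (@le_trans _ _ (r m.+2)) ?pinched_mono //; lia.
have := ler_wpM2l (ler0n R (m + 4)) h2; lra.
Qed.

End Estimates.

(** * The induction step *)

(** The coefficient at m + 7 of
    E = y E + y^5 + r (y^4 - y^3) + r E + 4 y^3 theta r + 2 y^2 (theta r)^2
        - 3 y^2 r - 3 y r^2 - r^3,
    which is the differential equation for 1 - y - r solved for its linear
    part. *)
Definition excess_rec (R : pzRingType) (r : nat -> R) (m : nat) : Prop :=
  excess r (m + 7) = excess r (m + 6) + conv r (excess r) (m + 7)
    + (4 * (m + 4)%:R - 1) * r (m + 4)%N + r (m + 3)%N - 3 * r (m + 5)%N
    + 2 * conv (euler r) (euler r) (m + 5)
    - 3 * conv r r (m + 6) - conv r (conv r r) (m + 7).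

(** With A, B, C the values of r at m + 5, m + 4, m + 3, all terms of
    [excess_rec] are compared with A: B <= 9/20 A by [pinched_step], and C is at
    most 3 / (2 (m+3)^2 - 4) A.  From above, the terms linear in B add up to
    (8 m + 29) B <= (3.6 m + 13.05) A, which stays below the allowed
    (4 m + 18) A, and the convolutions cost at most about (m / 4 + 3) A.  From
    below, the terms linear in B are nonnegative, and so are those in r E and
    2 y^2 (theta r)^2 together; - 3 A leaves a margin A, which covers - 3 y r^2
    and - r^3. *)
Lemma pinched_next (R : realFieldType) (r : nat -> R) (m : nat) :
  seeded r -> pinched_below r (m + 7) -> excess_rec r m -> pinched r (m + 5).
Proof.
move=> rS rP; rewrite /excess_rec => hrec.
have N7 : (7 <= m + 7)%N by exact: leq_addl.
have m5 : (m + 5 < m + 7)%N by lia.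
have m2 : (m.+2 < m + 7)%N by lia.
have m3 : (m.+3 < m + 7)%N by lia.
have e6 : (m + 6 = (m + 4).+2)%N by lia.
have e7 : ((m + 5).+2 = m + 7)%N by lia.
have /excess_pinched-/(_ ltac:(lia)) : pinched r (m + 4) by apply: rP; lia.
rewrite -e6 => /andP[E_ge E_le].
apply/excess_pinched; first by lia.
have A0 : 0 <= r (m + 5)%N by rewrite (pinched_ge0 rS N7 rP) //; lia.
have B0 : 0 <= r (m + 4)%N by rewrite (pinched_ge0 rS N7 rP) //; lia.
have C0 : 0 <= r (m + 3)%N by rewrite (pinched_ge0 rS N7 rP) //; lia.
have AB : 20 * r (m + 4)%N <= 9 * r (m + 5)%N.
  by rewrite [(m + 5)%N]addnS (pinched_step rS N7 rP) //; lia.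
have AC : 2 * ((m + 3)%:R ^+ 2 - 2) * r (m + 3)%N <= 3 * r (m + 5)%N.
  rewrite [(m + 5)%N](_ : _ = (m + 3).+2); last by lia.
  have /andP[] // : pinched r (m + 3) by apply: rP; lia.
have K0 : 0 <= conv r r (m + 5) by rewrite (conv_sqr_ge0 rS N7 rP) // ltnW.
have Q0 : 0 <= conv r r (m + 6) by rewrite (conv_sqr_ge0 rS N7 rP) // leq_add2l.
have S0 := conv_cube_ge0 rS N7 rP (leqnn (m + 7)).
have K_le : 3 * conv r r (m + 5) <= m%:R * r (m + 3)%N.
  rewrite (le_trans (conv_sqr_le rS N7 rP m2)) //.
  by rewrite ler_wpM2l // addn3 (pinched_mono rS N7 rP).
have Q_le : 3 * conv r r (m + 6) <= m.+1%:R * r (m + 3)%N.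
  by rewrite -addSnnS addn3 (conv_sqr_le rS N7 rP).
have /andP[rE_ge rE_le] := conv_excess_bounds rS N7 rP (leqnn _).
have /andP[T_ge T_le] := conv_euler_bounds rS N7 rP m5.
have S_le := conv_cube_le rS N7 rP (leqnn _).
(* What remains is an inequality between real numbers, in which the values of
   the sequences are abstracted. *)
rewrite e7 {}hrec; move: A0 B0 C0 AB AC K0 Q0 S0 K_le Q_le rE_ge rE_le T_ge T_le S_le E_ge E_le.
rewrite -[m.+1]addn1 !natrD.
move: (r (m + 5)%N) (r (m + 4)%N) (r (m + 3)%N) (excess r (m + 6)) (conv r (excess r) _)
  (conv (euler r) _ _) (conv r r (m + 6)) (conv r r (m + 5)) (conv r (conv r r) _).
have : (0 : R) <= m%:R by [].
move: m%:R; clear => x x0 A B C e cE T Q K S.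
move=> A0 B0 C0 AB AC K0 Q0 S0 K_le Q_le rE_ge rE_le T_ge T_le S_le E_ge E_le.
apply/andP; split.
  have QS : (x + 1 + (x + 4) ^+ 2 / 9) * C <= 2 / 3 * ((x + 3) ^+ 2 - 2) * C.
    by apply: ler_wpM2r => //; nra.
  have := mulr_ge0 x0 B0; lra.
have C1 : 14 * C <= 3 * A.
  have := mulr_ge0 (mulr_ge0 x0 x0) C0.
  have := mulr_ge0 x0 C0; lra.
have BA : (8 * x + 29) * (20 * B) <= (8 * x + 29) * (9 * A).
  by apply: ler_wpM2l => //; lra.
have KA : (x ^+ 2 + 18 * x + 37) * K <= (x + 12) / 2 * A.
  have h1 : (x ^+ 2 + 18 * x + 37) * (3 * K) <= (x ^+ 2 + 18 * x + 37) * (x * C).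
    by apply: ler_wpM2l => //; nra.
  have h2 : (x + 12) * (2 * ((x + 3) ^+ 2 - 2) * C) <= (x + 12) * (3 * A).
    by apply: ler_wpM2l => //; lra.
  have h3 : x * (x ^+ 2 + 18 * x + 37) * C <= (x + 12) * ((x + 3) ^+ 2 - 2) * C.
    by apply: ler_wpM2r => //; nra.
  lra.
have := mulr_ge0 x0 A0; lra.
Qed.

(** * The differential equation for the normalized series *)

Lemma coef_conv (R : comNzRingType) (p q : {poly R}) (f g : nat -> R) n :
  (forall i, (i <= n)%N -> p`_i = f i) -> (forall i, (i <= n)%N -> q`_i = g i) ->
  forall k, (k <= n)%N -> (p * q)`_k = conv f g k.
Proof.
move=> hp hq k kn; rewrite coefM; apply: eq_bigr => i _.
have ik : (i <= k)%N by rewrite -ltnS.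
by rewrite hp ?hq ?(leq_trans _ kn) ?leq_subr.
Qed.

(** The coefficient at n >= 2 of
    B^3 + 3 y B - 1 - 2 y^2 (B theta^2 B - (theta B)^2). *)
Definition balance (R : pzRingType) (b : nat -> R) (n : nat) : R :=
  conv b (conv b b) n + 3 * b n.-1
  - 2 * (conv b (euler (euler b)) (n - 2) - conv (euler b) (euler b) (n - 2)).

(** The sequence r with B = 1 - y - r. *)
Definition neg_tail (R : pzRingType) (b : nat -> R) (n : nat) : R :=
  if (n < 3)%N then 0 else - b n.

(** Passing from B to r = 1 - y - B and collecting the linear part in E is a
    polynomial identity in y, r, theta r and theta^2 r.  It is proved in the
    commutative ring of polynomials, for truncations that agree with the
    series up to the index considered. *)
Lemma balance_excess_rec (R : comNzRingType) (b : nat -> R) (m : nat) :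
  b 0 = 1 -> b 1 = -1 -> b 2 = 0 -> 3 * b 3 = -1 -> 3 * b 4 = -1 ->
  balance b (m + 7) = 0 -> excess_rec (neg_tail b) m.
Proof.
move=> b0 b1 b2 b3 b4.
set n := (m + 7)%N; set r := neg_tail b.
pose trunc (f : nat -> R) := \poly_(i < n.+1) f i.
have truncE f i : (i <= n)%N -> (trunc f)`_i = f i by move=> hi; rewrite coef_poly ltnS hi.
pose rp := trunc r; pose tp := trunc (euler r); pose sp := trunc (euler (euler r)).
pose ep : {poly R} := 3 * rp - 'X^3 - 'X^4 - 2 * ('X^2 * sp).
pose bp : {poly R} := 1 - 'X - rp.
pose tbp : {poly R} := - 'X - tp; pose sbp : {poly R} := - 'X - sp.
have bpE i : (i <= n)%N -> bp`_i = b i.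
  move=> hi; rewrite !coefB coef1 coefX truncE // /r /neg_tail.
  case: i hi => [|[|[|i]]] hi /=; rewrite ?b0 ?b1 ?b2; ring.
have tbpE i : (i <= n)%N -> tbp`_i = euler b i.
  move=> hi; rewrite coefB coefN coefX truncE // /r /neg_tail /euler.
  case: i hi => [|[|[|i]]] hi /=; rewrite ?b0 ?b1 ?b2; ring.
have sbpE i : (i <= n)%N -> sbp`_i = euler (euler b) i.
  move=> hi; rewrite coefB coefN coefX truncE // /r /neg_tail /euler.
  case: i hi => [|[|[|i]]] hi /=; rewrite ?b0 ?b1 ?b2; ring.
have epE i : (i <= n)%N -> ep`_i = excess r i.
  move=> hi; rewrite /ep !mulr_natl !(coefB, coefMn, coefXnM, coefXn).
  rewrite truncE // /excess; case: i hi => [|[|[|[|[|i]]]]] hi.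
  - by rewrite /r /neg_tail /=; ring.
  - by rewrite /r /neg_tail /=; ring.
  - by rewrite truncE // /r /neg_tail /euler /=; ring.
  - rewrite truncE ?(leq_trans _ hi) // /r /neg_tail /euler /=.
    by transitivity (- (3 * b 3) - 1); [ring|rewrite b3; ring].
  - rewrite truncE ?(leq_trans _ hi) // /r /neg_tail /euler /=.
    by transitivity (- (3 * b 4) - 1); [ring|rewrite b4; ring].
  rewrite truncE ?(leq_trans _ hi) ?leq_subr //= /euler; ring.
have key : ep + (bp * (bp * bp) + 3 * ('X * bp) - 1 - 2 * ('X^2 * (bp * sbp - tbp * tbp)))
  = 'X * ep + 'X^5 + 'X^4 * rp - 'X^3 * rp + rp * ep + 4 * ('X^3 * tp)
    + 2 * ('X^2 * (tp * tp)) - 3 * ('X^2 * rp) - 3 * ('X * (rp * rp)) - rp * (rp * rp).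
  by rewrite /bp /tbp /sbp /ep; ring.
have rpE i : (i <= n)%N -> rp`_i = r i by apply: truncE.
have tpE i : (i <= n)%N -> tp`_i = euler r i by apply: truncE.
have n1 : n.-1 = (m + 6)%N by rewrite /n; lia.
have n2 : (n - 2 = m + 5)%N by rewrite /n; lia.
have n3 : (n - 3 = m + 4)%N by rewrite /n; lia.
have n4 : (n - 4 = m + 3)%N by rewrite /n; lia.
have n7 : (7 <= n)%N by apply: leq_addl.
have ltF k : (k < 7)%N -> (n < k)%N = false.
  by move=> k7; apply/negbTE; rewrite -leqNgt (leq_trans (ltnW k7)).
have eqF k : (k < 7)%N -> (n == k)%N = false.
  by move=> k7; apply/gtn_eqF/(leq_trans k7).
have le i : (i <= 7)%N -> (m + i <= n)%N by move=> hi; rewrite leq_add2l.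
rewrite /balance n1 n2 => hb.
have /= := congr1 (fun p : {poly R} => p`_n) key.
clearbody rp tp sp ep bp tbp sbp.
rewrite !mulr_natl !(coefB, coefD, coefMn, coefXnM, coefXn, coefXM, coef1).
rewrite !ltF // !eqF // n1 n2 n3 n4.
rewrite (coef_conv rpE epE) // (coef_conv bpE (coef_conv bpE bpE)) //.
rewrite (coef_conv bpE sbpE) ?le // (coef_conv tbpE tbpE) ?le //.
rewrite (coef_conv tpE tpE) ?le // (coef_conv rpE rpE) ?le //.
rewrite (coef_conv rpE (coef_conv rpE rpE)) //.
rewrite !epE ?le // !rpE ?le // !tpE ?le // bpE ?le // => e.
(* The left-hand side gains the vanishing summand [balance b n]. *)
rewrite /excess_rec -/n -[LHS]addr0 -{1}hb.
refine (etrans (etrans _ e) _); rewrite /euler ?mulr0n; ring.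
Qed.

(** The original recurrence for alpha = 1/2, beta = 1, a_0 = 1, up to a
    factor 2. *)
Definition normalized_rec (R : pzRingType) (b : nat -> R) (n : nat) : Prop :=
  3 * b n = - (\sum_(1 <= k < n) b k * \sum_(0 <= j < (n - k).+1) b j * b (n - k - j)%N)
    - \sum_(1 <= k < n) b k * b (n - k)%N - 3 * b n.-1
    + 2 * \sum_(1 <= k < n.-1) (2 * k%:R ^+ 2 + k%:R * (2 - n%:R)) * b k * b (n - 2 - k)%N.

Lemma conv_nat (R : pzRingType) (f g : nat -> R) n :
  conv f g n = \sum_(0 <= i < n.+1) f i * g (n - i)%N.
Proof. by rewrite big_mkord. Qed.

Lemma conv_ends (R : pzRingType) (f g : nat -> R) n : (0 < n)%N ->
  conv f g n = f 0 * g n + \sum_(1 <= i < n) f i * g (n - i)%N + f n * g 0.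
Proof.
by move=> n0; rewrite conv_nat big_nat_recr //= subnn big_ltn // subn0.
Qed.

(** The terms with b_n, which the recurrence isolates, are the two ends of the
    sums for B^3; the derivative terms agree after reversing one of the
    convolutions, as k^2 - k (n-2-k) = 2 k^2 + k (2-n). *)
Lemma normalized_balance (R : comPzRingType) (b : nat -> R) (n : nat) :
  b 0 = 1 -> (2 <= n)%N -> normalized_rec b n -> balance b n = 0.
Proof.
move=> b0 n2; rewrite /normalized_rec /balance => hb.
have n0 : (0 < n)%N by apply: leq_trans n2.
have conv0 : conv b b 0 = 1 by rewrite /conv big_ord1 b0 mulr1.
rewrite conv_ends // conv0 conv_ends // b0.
have -> : \sum_(1 <= k < n) b k * conv b b (n - k) =
    \sum_(1 <= k < n) b k * \sum_(0 <= j < (n - k).+1) b j * b (n - k - j)%N.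
  by apply: eq_bigr => k _; rewrite conv_nat.
have -> : conv b (euler (euler b)) (n - 2) - conv (euler b) (euler b) (n - 2) =
    \sum_(1 <= k < n.-1) (2 * k%:R ^+ 2 + k%:R * (2 - n%:R)) * b k * b (n - 2 - k)%N.
  have -> : conv b (euler (euler b)) (n - 2) = conv (euler (euler b)) b (n - 2).
    rewrite !conv_nat big_nat_rev; apply: eq_big_nat => i /andP[_ hi] /=.
    by rewrite add0n subSS mulrC subKn.
  rewrite !conv_nat -sumrB -subSn // subSS subn1 big_ltn; last by rewrite -ltnS prednK.
  rewrite /euler !mul0r subrr add0r; apply: eq_big_nat => i /andP[_ hi].
  rewrite !natrB //; [ring|lia].
ring: hb.
Qed.

(** * Factorial bounds for the normalized coefficients *)

Lemma neg_tail_seeded (R : realFieldType) (b : nat -> R) :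
  b 0 = 1 -> b 1 = -1 -> b 2 = 0 -> b 3 = - (1 / 3) ->
  (forall n, (4 <= n)%N -> normalized_rec b n) -> seeded (neg_tail b).
Proof.
move=> b0 b1 b2 b3 hb.
have b4 : b 4 = - (1 / 3).
  have := hb 4 isT; rewrite /normalized_rec unlock /=.
  rewrite b0 b1 b2 b3; lra.
have b5 : b 5 = - 2.
  have := hb 5 isT; rewrite /normalized_rec unlock /=.
  rewrite b0 b1 b2 b3 b4; lra.
have b6 : b 6 = - (40 / 9).
  have := hb 6 isT; rewrite /normalized_rec unlock /=.
  rewrite b0 b1 b2 b3 b4 b5; lra.
by split; rewrite /neg_tail /= ?b3 ?b4 ?b5 ?b6 ?opprK // => i ->.
Qed.

Lemma neg_tail_pinched (R : realFieldType) (b : nat -> R) :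
  b 0 = 1 -> b 1 = -1 -> b 2 = 0 -> b 3 = - (1 / 3) ->
  (forall n, (4 <= n)%N -> normalized_rec b n) ->
  forall m, (3 <= m)%N -> pinched (neg_tail b) m.
Proof.
move=> b0 b1 b2 b3 hb.
have rS := neg_tail_seeded b0 b1 b2 b3 hb.
have [_ r3 r4 r5 r6] := rS.
have b4 : b 4 = - (1 / 3) by rewrite -[LHS]opprK -r4.
elim/ltn_ind=> m IH m3.
have [m4|m4] := ltnP m 5.
  have [->|->] : (m = 3 \/ m = 4)%N by lia.
    by rewrite /pinched r3 r5; apply/andP; split; lra.
  by rewrite /pinched r4 r6; apply/andP; split; lra.
have [k mE] : exists k, m = (k + 5)%N by exists (m - 5)%N; lia.
rewrite mE in IH *.
apply: (pinched_next rS); first by move=> i i3 ik; apply: IH; lia.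
apply: balance_excess_rec => //; rewrite ?b3 ?b4; try lra.
by apply: normalized_balance; [exact: b0|lia|apply: hb; lia].
Qed.

(** For m >= 3 the two-step factors satisfy
    (m+2) (m+1) / 9 <= 2 (m^2 - 2) / 3 and
    2 ((m+1)^2 - 2) / 3 <= (m+2) (m+1). *)
Lemma pinched_fact_bounds (R : realFieldType) (r : nat -> R) :
  seeded r -> (forall m, (3 <= m)%N -> pinched r m) ->
  forall n, (3 <= n)%N -> n`!%:R / 3 ^+ n <= r n <= n`!%:R.
Proof.
move=> [r0 r3 r4 r5 r6] rP; elim/ltn_ind=> n IH n3.
have [n5|n5] := ltnP n 5.
  have [->|->] : (n = 3 \/ n = 4)%N by lia.
    by rewrite r3 (_ : 3`! = 6)%N //; apply/andP; split; lra.
  by rewrite r4 (_ : 4`! = 24)%N //; apply/andP; split; lra.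
have [m mE] : exists m, n = m.+2 by exists (n - 2)%N; lia.
rewrite mE in n5 IH *; have m3 : (3 <= m)%N by lia.
have /andP[lo hi] := IH m ltac:(lia) m3.
have /andP[p q] := rP m m3.
rewrite !factS !natrM 2!exprS !invfM.
move: lo hi p q; set L := _ / 3 ^+ m; set F := (m`!)%:R => lo hi p q.
have L0 : 0 <= L by rewrite divr_ge0 // exprn_ge0.
have m3' : (3 : R) <= m%:R by rewrite ler_nat.
rewrite -[m.+2%:R]natr1; rewrite -[m.+1%:R]natr1 in q *.
set x : R := m%:R in p q m3' *.
have F0 : 0 <= F by [].
have -> : (x + 1 + 1) * ((x + 1) * F) * (3^-1 * (3^-1 * (3 ^+ m)^-1))
    = (x + 2) * (x + 1) / 9 * L.
  by rewrite /L; field; rewrite expf_neq0 // lt0r_neq0.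
have e1 : (x + 2) * (x + 1) / 9 * L <= (2 / 3 * (x ^+ 2 - 2)) * L.
  by apply: ler_wpM2r => //; nra.
have e2 : (2 / 3 * (x ^+ 2 - 2)) * L <= (2 / 3 * (x ^+ 2 - 2)) * r m.
  by apply: ler_wpM2l => //; nra.
have e3 : (2 / 3 * ((x + 1) ^+ 2 - 2)) * r m <= (2 / 3 * ((x + 1) ^+ 2 - 2)) * F.
  by apply: ler_wpM2l => //; nra.
have e4 : (2 / 3 * ((x + 1) ^+ 2 - 2)) * F <= (x + 2) * (x + 1) * F.
  by apply: ler_wpM2r => //; nra.
by apply/andP; split; lra.
Qed.

Lemma normalized_fact_bounds (R : realFieldType) (b : nat -> R) :
  b 0 = 1 -> b 1 = -1 -> b 2 = 0 -> b 3 = - (1 / 3) ->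
  (forall n, (4 <= n)%N -> normalized_rec b n) ->
  (forall n, `|b n| <= n`!%:R) /\
  (forall n, (3 <= n)%N -> n`!%:R / 3 ^+ n <= `|b n|).
Proof.
move=> b0 b1 b2 b3 hb.
have bnd n : (3 <= n)%N -> n`!%:R / 3 ^+ n <= `|b n| <= n`!%:R.
  move=> n3; have := pinched_fact_bounds (neg_tail_seeded b0 b1 b2 b3 hb)
    (neg_tail_pinched b0 b1 b2 b3 hb) n3.
  rewrite /neg_tail ltnNge n3 /= => /andP[lo hi].
  have p0 : 0 <= - b n by apply: le_trans lo; rewrite divr_ge0 // exprn_ge0.
  by rewrite -normrN ger0_norm // lo hi.
split=> n; last by move=> /bnd/andP[].
have [n3|/bnd/andP[]//] := ltnP n 3.
by case: n n3 => [|[|[|]]] // _; rewrite ?b0 ?b1 ?b2 ?normrN ?normr1 ?normr0.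
Qed.

(** * Factorials outgrow geometric sequences *)

(** For m >= 2 |B| one has m^n <= m^m n!, hence 2^n |B|^n <= m^m n!. *)
Lemma fact_outgrows (R : archiRealFieldType) (A B : R) :
  exists2 n, (3 <= n)%N & A * B ^+ n < n`!%:R.
Proof.
have [m hm] : exists m : nat, 2 * (`|B| + 1) < m%:R.
  exists (Num.truncn (2 * (`|B| + 1))).+1; exact: Num.Theory.truncnS_gt.
have m0 : (0 : R) < m%:R by apply: le_lt_trans hm; have := normr_ge0 B; lra.
have mfact n : (m%:R : R) ^+ n <= m%:R ^+ m * n`!%:R.
  elim: n => [|n IH].
    rewrite expr0 fact0 mulr1 exprn_ege1 // ler1n; by move: m0; rewrite ltr0n.
  have [nm|nm] := leqP n.+1 m.
    rewrite (@le_trans _ _ (m%:R ^+ m)) //.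
      by rewrite ler_weXn2l // ler1n; move: m0; rewrite ltr0n.
    by rewrite ler_peMr ?exprn_ge0 // ler1n fact_gt0.
  rewrite exprS factS natrM mulrCA ler_pM ?exprn_ge0 ?ler_nat //; exact: ltnW.
have [k hk] : exists k : nat, `|A| * m%:R ^+ m < k%:R.
  exists (Num.truncn (`|A| * m%:R ^+ m)).+1; exact: Num.Theory.truncnS_gt.
exists k.+3 => //; set n := k.+3.
have kn : (k%:R : R) <= 2 ^+ n.
  by rewrite -natrX ler_nat (leq_trans (ltnW (ltn_expl k (ltnSn 1)))) ?leq_exp2l // /n -addn3 leq_addr.
have hB : (2 * `|B|) ^+ n <= m%:R ^+ n.
  by rewrite lerXn2r ?nnegrE ?mulr_ge0 //; have := normr_ge0 B; lra.
have P0 : (0 : R) < n`!%:R by rewrite ltr0n fact_gt0.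
have E0 : (0 : R) < 2 ^+ n by rewrite exprn_gt0.
rewrite -(ltr_pM2l E0) (@le_lt_trans _ _ (`|A| * m%:R ^+ m * n`!%:R)) //.
  rewrite -mulrA mulrCA (le_trans (ler_norm _)) // normrM normrM.
  rewrite !normrX [`|2|]ger0_norm // -exprMn ler_wpM2l //.
  exact: le_trans hB (mfact n).
by rewrite ltr_pM2r // (lt_le_trans hk).
Qed.

Lemma fact_powR_outgrows (R : realType) (k B C : R) : 1 < k -> 0 < B -> 0 < C ->
  ~ (forall n, (3 <= n)%N -> n`!%:R <= C * n`!%:R `^ k^-1 * B ^+ n).
Proof.
move=> k1 B0 C0 h; pose s := 1 - k^-1.
have s0 : 0 < s by rewrite subr_gt0 invf_lt1 // (lt_trans ltr01).
have [n n3 hn] := fact_outgrows (C `^ s^-1) (B `^ s^-1).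
have F0 : (0 : R) < n`!%:R by rewrite ltr0n fact_gt0.
have hs : n`!%:R `^ s <= C * B ^+ n.
  rewrite powRB ?(powRr1 (ltW F0)) //; last by rewrite (gt_eqF F0) /= implybT.
  by rewrite ler_pdivrMr ?powR_gt0 // mulrAC h.
have : n`!%:R <= C `^ s^-1 * (B `^ s^-1) ^+ n.
  have -> : n`!%:R = (n`!%:R `^ s) `^ s^-1 :> R.
    by rewrite -powRrM divff ?gt_eqF // powRr1 // ltW.
  have [B0' C0'] := (ltW B0, ltW C0).
  rewrite -powR_mulrn ?powR_ge0 // [(B `^ _) `^ _]powRAC powR_mulrn // -powRM ?exprn_ge0 //.
  rewrite ge0_ler_powR ?nnegrE ?powR_ge0 ?mulr_ge0 ?exprn_ge0 //.
  by rewrite invr_ge0 ltW.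
by rewrite leNgt hn.
Qed.

(** * Scaling the parameters out *)

(** The weights u^2 and u^3 and the power of t that the terms carry are matched
    by alpha and beta exactly because of the two relations assumed between
    alpha, beta, u and t. *)
Lemma rescale_rec (F : numFieldType) (alpha beta u t : F) (a c : nat -> F) (n : nat) :
  u != 0 -> t != 0 -> alpha = (2 * t ^+ 2 * u)^-1 -> beta = u / t ->
  (forall k, a k = u * t ^+ k * c k) -> (4 <= n)%N ->
  a n = 1 / (3 * alpha * u ^+ 2) *
      (- (alpha * \sum_(1 <= k < n) a k *
                    \sum_(0 <= j < (n - k).+1) a j * a (n - k - j)%N)
       - alpha * u * \sum_(1 <= k < n) a k * a (n - k)%N
       - 3 / 2 * beta * a n.-1
       + \sum_(1 <= k < n.-1)
           (2 * k%:R ^+ 2 + k%:R * (2 - n%:R)) * a k * a (n - 2 - k)%N) ->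
  normalized_rec c n.
Proof.
move=> u0 t0 -> -> aE n4; rewrite /normalized_rec.
set S3 := (X in _ = - X - _ - _ + _); set S2 := (X in _ = _ - X - _ + _).
set Sd := (X in _ = _ + 2 * X).
have [m mE] : exists m, n = m.+2 by exists (n - 2)%N; lia.
have -> : \sum_(1 <= k < n) a k * \sum_(0 <= j < (n - k).+1) a j * a (n - k - j)%N
    = u ^+ 3 * t ^+ n * S3.
  rewrite mulr_sumr; apply: eq_big_nat => k /andP[k1 kn].
  rewrite !mulr_sumr; apply: eq_big_nat => j /andP[_ jn]; rewrite !aE.
  have -> : t ^+ n = t ^+ k * t ^+ j * t ^+ (n - k - j) by rewrite -!exprD; congr (_ ^+ _); lia.
  by ring.
have -> : \sum_(1 <= k < n) a k * a (n - k)%N = u ^+ 2 * t ^+ n * S2.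
  rewrite mulr_sumr; apply: eq_big_nat => k /andP[k1 kn]; rewrite !aE.
  have -> : t ^+ n = t ^+ k * t ^+ (n - k) by rewrite -!exprD; congr (_ ^+ _); lia.
  by ring.
have -> : \sum_(1 <= k < n.-1)
    (2 * k%:R ^+ 2 + k%:R * (2 - n%:R)) * a k * a (n - 2 - k)%N = u ^+ 2 * t ^+ m * Sd.
  rewrite mulr_sumr; apply: eq_big_nat => k /andP[k1 kn]; rewrite !aE.
  have -> : t ^+ m = t ^+ k * t ^+ (n - 2 - k) by rewrite -!exprD; congr (_ ^+ _); lia.
  by ring.
clearbody S3 S2 Sd; rewrite !aE mE /= => h.
have f0 : u * t ^+ m.+2 != 0 by rewrite mulf_neq0 // expf_neq0.
apply: (mulfI f0); rewrite mulrCA h !exprS; field.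
by rewrite u0 t0.
Qed.

(** Lets the recurrence descend from the complex to the real numbers. *)
Lemma normalized_rec_inj (R S : comPzRingType) (f : {rmorphism R -> S})
    (b : nat -> R) (c : nat -> S) n :
  injective f -> (forall k, c k = f (b k)) -> normalized_rec c n ->
  normalized_rec b n.
Proof.
move=> finj cb h; apply: finj; move: h; rewrite /normalized_rec !cb.
rewrite !(rmorph_nat, rmorphM, rmorphD, rmorphN) !rmorph_sum => ->.
congr (_ + 2 * _); last first.
  by apply: eq_bigr => k _; rewrite !cb !(rmorph_nat, rmorphXn, rmorphM, rmorphD, rmorphN).
congr (- _ - _ - _).
  apply: eq_bigr => k _; rewrite cb rmorphM rmorph_sum; congr (_ * _).
  by apply: eq_bigr => j _; rewrite !cb rmorphM.
by apply: eq_bigr => k _; rewrite !cb rmorphM.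
Qed.

Lemma normalized_real (R : numFieldType) (c : nat -> R) :
  (forall i, (i < 4)%N -> c i \is Num.real) ->
  (forall n, (4 <= n)%N -> normalized_rec c n) ->
  forall n, c n \is Num.real.
Proof.
move=> c03 hc; elim/ltn_ind=> n IH; have [/c03//|n4] := ltnP n 4.
have -> : c n = 3^-1 * (3 * c n) by field.
rewrite (hc n n4) rpredM ?rpredV ?rpred_nat //.
rewrite !rpredD ?rpredN ?rpredM ?rpred_nat //.
- rewrite big_seq rpred_sum // => k; rewrite mem_index_iota => kn.
  rewrite rpredM //; first by apply: IH; lia.
  rewrite big_seq rpred_sum // => j; rewrite mem_index_iota => jn.
  by rewrite rpredM //; apply: IH; lia.
- rewrite big_seq rpred_sum // => k; rewrite mem_index_iota => kn.
  by rewrite rpredM //; apply: IH; lia.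
- by apply: IH; lia.
rewrite big_seq rpred_sum // => k; rewrite mem_index_iota => kn.
rewrite !rpredM //; try by apply: IH; lia.
by rewrite rpredD ?rpredM ?rpredB ?rpredX ?rpred_nat.
Qed.

(** * The coefficients of the formal solution *)

Theorem theorem1 (R : realType) (alpha beta delta : R[i]) (a : nat -> R[i])
  (halphabeta : alpha * beta != 0)
  (hdelta : delta = - (beta ^+ 2 / 2))
  (ha0 : a 0%N ^+ 3 = - delta / alpha)
  (ha1 : a 1%N = - (beta / (2 * alpha * a 0%N)))
  (ha2 : a 2%N = 0)
  (ha3 : a 3%N = - (beta / (6 * alpha ^+ 2 * a 0%N ^+ 2))
                 * (beta ^+ 2 / (4 * delta) + 1))
  (ha : forall n : nat, (4 <= n)%N ->
    a n = 1 / (3 * alpha * a 0%N ^+ 2) *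
      (- (alpha * \sum_(1 <= k < n) a k *
                    \sum_(0 <= j < (n - k).+1) a j * a (n - k - j)%N)
       - alpha * a 0%N * \sum_(1 <= k < n) a k * a (n - k)%N
       - 3 / 2 * beta * a n.-1
       + \sum_(1 <= k < n.-1)
           (2 * k%:R ^+ 2 + k%:R * (2 - n%:R)) * a k * a (n - 2 - k)%N)) :
  exact_gevrey (1 : R) a.
Proof.
move: halphabeta; rewrite mulf_eq0 negb_or => /andP[al0 be0].
set u := a 0 in ha0 ha1 ha2 ha3 ha.
have u0 : u != 0.
  have : u ^+ 3 != 0.
    by rewrite ha0 hdelta opprK !mulf_neq0 ?invr_neq0 ?expf_neq0 ?pnatr_eq0.
  by apply: contraNneq => ->; rewrite expr0n.
pose t := beta / (2 * alpha * u ^+ 2).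
have t0 : t != 0 by rewrite !mulf_neq0 ?invr_neq0 ?mulf_neq0 ?expf_neq0 ?pnatr_eq0.
(* With delta = - beta^2 / 2 this ties the two scales alpha and beta together,
   so that no parameter survives the rescaling. *)
have scale : 2 * alpha * u ^+ 3 = beta ^+ 2 by rewrite ha0 hdelta; field.
have beE : beta = u / t.
  by rewrite /t; field: scale; rewrite u0 al0 be0.
have alE : alpha = (2 * t ^+ 2 * u)^-1.
  by rewrite /t; field: scale; rewrite u0 al0.
pose c n := a n / (u * t ^+ n).
have ac n : a n = u * t ^+ n * c n.
  by rewrite /c mulrC divfK // mulf_neq0 // expf_neq0.
have c0 : c 0 = 1 by rewrite /c expr0 mulr1 divff.
have c1 : c 1 = -1.
  by rewrite /c ha1 /t; field; rewrite u0 al0 be0.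
have c2 : c 2 = 0 by rewrite /c ha2 mul0r.
have c3 : c 3 = - (1 / 3).
  by rewrite /c ha3 hdelta beE alE; field; rewrite u0 t0.
have hc n : (4 <= n)%N -> normalized_rec c n.
  by move=> n4; apply: (rescale_rec u0 t0 alE beE ac n4 (ha n n4)).
have creal : forall n, c n \is Num.real.
  apply: normalized_real hc => i; case: i => [|[|[|[|]]]] // _.
  - by rewrite c0 rpred1.
  - by rewrite c1 rpredN rpred1.
  - by rewrite c2 rpred0.
  by rewrite c3 rpredN rpredM ?rpredV ?rpred_nat ?rpred1.
pose b n := complex.Re (c n).
have cb n : c n = (b n)%:C by rewrite /b RRe_real.
have [up lo] : (forall n, `|b n| <= n`!%:R) /\
    (forall n, (3 <= n)%N -> n`!%:R / 3 ^+ n <= `|b n|).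
  apply: normalized_fact_bounds; try apply: (@complexI R); rewrite -?cb.
  - by rewrite c0.
  - by rewrite c1 rmorphN1.
  - by rewrite c2.
  - by rewrite c3 rmorphN fmorph_div rmorph_nat.
  by move=> n n4; apply: (normalized_rec_inj (@complexI R) cb (hc n n4)).
have [A AE] : exists A : R, `|u| = A%:C by apply/complex_realP/normr_real.
have [T TE] : exists T : R, `|t| = T%:C by apply/complex_realP/normr_real.
have A0 : 0 < A by rewrite -ltcR -AE normr_gt0.
have T0 : 0 < T by rewrite -ltcR -TE normr_gt0.
have normb n : `|(b n)%:C| = `|b n|%:C.
  by rewrite normc_def /= expr0n addr0 sqrtr_sqr.
have norma n : `|a n| = (A * T ^+ n * `|b n|)%:C.
  by rewrite ac cb !normrM normrX AE TE normb !(rmorphM, rmorphXn).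
split.
  split=> //; exists T, A; split=> // n.
  rewrite norma lecR invr1 powRr1 // mulrAC.
  by rewrite ler_wpM2r ?exprn_ge0 ?(ltW T0) // ler_wpM2l ?up // ltW.
move=> [k [k1 [_ [M [C [M0 C0 hM]]]]]].
have B0 : 0 < 3 * M / T by rewrite divr_gt0 // mulr_gt0.
apply: (fact_powR_outgrows k1 B0 (divr_gt0 C0 A0)) => n n3.
have := hM n; rewrite norma lecR => hn.
have D0 : 0 < A * T ^+ n / 3 ^+ n by rewrite divr_gt0 ?mulr_gt0 ?exprn_gt0.
have -> : C / A * n`!%:R `^ k^-1 * (3 * M / T) ^+ n =
    C * n`!%:R `^ k^-1 * M ^+ n / (A * T ^+ n / 3 ^+ n).
  rewrite expr_div_n exprMn; field.
  by rewrite (gt_eqF A0) !expf_neq0 ?pnatr_eq0 ?(gt_eqF T0).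
rewrite ler_pdivlMr //; apply: le_trans hn.
rewrite mulrCA ler_wpM2l ?lo //.
by rewrite mulr_ge0 ?exprn_ge0 // ltW.
Qed.
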